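(* Let $M$ be an $n\times n$ symmetric matrix over $\mathbb{GF}(2)$ with rows and columns indexed by a finite set $V$. Let $u,v\in V$ be distinct and $V'=V\setminus\{u,v\}$. Suppose that $$M=\begin{bmatrix}0&1&P^T\\1&0&Q^T\\P&Q&N\end{bmatrix},$$ where the block rows and block columns are indexed by $\{u\}$, $\{v\}$ and $V'$. Then $$P_{\langle\delta\tau\delta\rangle}(M,z)=z^{\operatorname{rank}(M)}\Big(z^{-\operatorname{rank}(N)}P_{\langle\delta\tau\delta\rangle}(N,z)+z^{-\operatorname{rank}(N+QQ^T)}P_{\langle\delta\tau\delta\rangle}(N+QQ^T,z)+z^{-\operatorname{rank}(H)}P_{\langle\delta\tau\delta\rangle}(H,z)\Big),$$ where $$H=\begin{bmatrix}1&(P+Q)^T\\P+Q&N+PP^T\end{bmatrix}.$$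
   Context: All matrices are over $\mathbb{GF}(2)$. For a square matrix $C$ with rows and columns indexed by a finite set $W$, the partial-$\langle\delta\tau\delta\rangle$ polynomial of $C$ is $$P_{\langle\delta\tau\delta\rangle}(C,z)=\sum_{A\subseteq W}z^{\operatorname{rank}(C)-\operatorname{corank}((C+I_A)[A])},$$ where $I_A$ is the diagonal matrix indexed by $W$ with diagonal entry $1$ at indices in $A$ and $0$ otherwise, $C[A]$ denotes the principal submatrix of $C$ on $A$, and the corank of a $k\times k$ matrix is $k$ minus its rank. The empty matrix has rank and corank $0$ (so its polynomial is $1$). The matrices $N$ and $N+QQ^T$ are indexed by $V'$, and $H$ is indexed by $\{r\}\cup V'$ with $r$ a new index. Identities are understood in the ring of Laurent polynomials in $z$. *)

(* Defs.v *)
From mathcomp Require Import all_boot all_order all_algebra.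

Set Implicit Arguments.
Unset Strict Implicit.
Unset Printing Implicit Defensive.

Import GRing.Theory.
Local Open Scope ring_scope.

(* Square matrices over GF(2) whose rows and columns are both indexed by an
   arbitrary finite type; the type 'M_n only allows the index type 'I_n. *)
Definition fmatrix (W : finType) := W -> W -> 'F_2.

(* The principal submatrix C[A], with A listed in the order of enum A. *)
Definition principal (W : finType) (C : fmatrix W) (A : {set W}) :
    'M['F_2]_#|A| :=
  \matrix_(i < #|A|, j < #|A|) C (enum_val i) (enum_val j).

Definition fmx_rank (W : finType) (C : fmatrix W) : nat :=
  \rank (principal C [set: W]).

Definition corank (k : nat) (B : 'M['F_2]_k) : nat := (k - \rank B)%N.

Definition fmx_add (W : finType) (C D : fmatrix W) : fmatrix W :=
  fun x y => C x y + D x y.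

(* The matrix I_A. *)
Definition fmx_diag (W : finType) (A : {set W}) : fmatrix W :=
  fun x y => ((x == y) && (x \in A))%:R.

(* The outer product q q^T. *)
Definition fmx_outer (W : finType) (q : W -> 'F_2) : fmatrix W :=
  fun x y => q x * q y.

(* The symmetric block matrix [a, b^T; b, C]; its first index is None. *)
Definition fmx_border (W : finType) (a : 'F_2) (b : W -> 'F_2)
    (C : fmatrix W) : fmatrix (option W) :=
  fun x y =>
    match x, y with
    | None, None => a
    | None, Some y' => b y'
    | Some x', None => b x'
    | Some x', Some y' => C x' y'
    end.

(* The field of rational functions in z. The Laurent polynomial ring
   Z[z, z^-1] is its subring generated by z and z^-1, so an identity between
   Laurent polynomials is an equality in this field. *)
Definition laurent_field := {fraction {poly int}}.

Definition z : laurent_field := FracField.tofrac 'X.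

(* The partial-<delta tau delta> polynomial of C. *)
Definition partial_dtd (W : finType) (C : fmatrix W) : laurent_field :=
  \sum_(A : {set W})
    z ^ ((fmx_rank C)%:Z
         - (corank (principal (fmx_add C (fmx_diag A)) A))%:Z).

(* The index set V \ {u, v}. *)
Definition minus2 (V : finType) (u v : V) : finType :=
  {x : V | x \notin [set u; v]}.

(* Main.v *)
(** Dividing P(C, z) by z^rank(C) leaves S(C), the sum over A of
    z^(- corank((C + I)[A])).  If C has diagonal entry 0 at an index x, then
    C + I has entry 1 there.  The sets A avoiding x contribute S of C with x
    deleted; for the sets containing x, taking the Schur complement of that
    entry 1 preserves the corank, so they contribute S of C with x deleted
    and the outer product of column x with row x added.  Pivoting M on u
    splits S(M) into S([0, Q^T; Q, N]) + S(H), and pivoting the first of these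
    on v splits it into S(N) + S(N + Q Q^T). *)
Require Import Defs.
From mathcomp Require Import all_boot all_order all_algebra.

Set Implicit Arguments.
Unset Strict Implicit.
Unset Printing Implicit Defensive.

Import GRing.Theory.
Local Open Scope ring_scope.

(** Selected rows span a subspace of the row space; transposing gives the same for columns. *)
Lemma mxrank_mxsub_le (F : fieldType) (m n m' n' : nat) (f : 'I_m' -> 'I_m)
    (g : 'I_n' -> 'I_n) (A : 'M[F]_(m, n)) :
  (\rank (mxsub f g A) <= \rank A)%N.
Proof.
have rowle p q r (h : 'I_r -> 'I_p) (B : 'M[F]_(p, q)) :
    (\rank (rowsub h B) <= \rank B)%N by exact: mxrankS (rowsub_sub h B).
have -> : mxsub f g A = rowsub f (rowsub g A^T)^T.
  by apply/matrixP=> i j; rewrite !mxE.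
by apply: leq_trans (rowle _ _ _ _ _) _; rewrite mxrank_tr -(mxrank_tr A) rowle.
Qed.

(** Block LDU factorization: the outer factors are unitriangular, hence invertible, and the middle
    one is the block diagonal of 1 and the Schur complement. *)
Lemma mxrank_block_pivot (F : fieldType) (n : nat) (b : 'rV[F]_n)
    (c : 'cV[F]_n) (D : 'M[F]_n) :
  \rank (block_mx 1%:M b c D : 'M_(1 + n)) = (\rank (D - c *m b)).+1.
Proof.
have -> : block_mx 1%:M b c D = block_mx 1%:M 0 c 1%:M
    *m block_mx 1%:M 0 0 (D - c *m b) *m block_mx 1%:M b 0 1%:M.
  rewrite !mulmx_block !(mulmx1, mul1mx, mulmx0, mul0mx, addr0, add0r).
  by rewrite addrC subrK.
rewrite mxrankMfree; last first.
  by rewrite row_free_unit unitmxE det_ublock !det1 mul1r unitr1.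
rewrite (eqmxMfull _ (_ : row_full _)) ?rank_diag_block_mx ?mxrank1 //.
by rewrite row_full_unit unitmxE det_lblock !det1 mul1r unitr1.
Qed.

(** Each of the two matrices is an [mxsub] of the other, so the ranks bound each other. This lets a
    principal submatrix be listed in any convenient order, without casting [k] to [#|A|]. *)
Lemma mxrank_principal (W : finType) (C : fmatrix W) (A : {set W}) (k : nat)
    (f : 'I_k -> W) :
  injective f -> f @: setT = A ->
  \rank (\matrix_(i, j) C (f i) (f j)) = \rank (principal C A).
Proof.
move=> inj_f im_f; have f_in i : f i \in A by rewrite -im_f imset_f ?inE.
have f_onto (j : 'I_#|A|) : exists i, f i == enum_val j.
  have: enum_val j \in f @: setT by rewrite im_f enum_valP.
  by case/imsetP=> i _ ->; exists i.
pose s i := enum_rank_in (f_in i) (f i).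
pose t j := xchoose (f_onto j).
apply/eqP; rewrite eqn_leq; apply/andP; split.
  have -> : \matrix_(i, j) C (f i) (f j) = mxsub s s (principal C A).
    by apply/matrixP=> i j; rewrite !mxE !enum_rankK_in.
  exact: mxrank_mxsub_le.
have -> : principal C A = mxsub t t (\matrix_(i, j) C (f i) (f j)).
  by apply/matrixP=> i j; rewrite !mxE !(eqP (xchooseP (f_onto _))).
exact: mxrank_mxsub_le.
Qed.

Lemma corank_imset (W W' : finType) (h : W -> W') (C : fmatrix W')
    (D : fmatrix W) (A : {set W}) :
  injective h -> {in A &, forall x y, C (h x) (h y) = D x y} ->
  corank (principal C (h @: A)) = corank (principal D A).
Proof.
move=> inj_h CD; rewrite /corank.
rewrite -(@mxrank_principal _ C _ _ (h \o @enum_val W (mem A))).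
- rewrite card_imset //; congr (_ - \rank _)%N.
  by apply/matrixP=> i j; rewrite !mxE CD ?enum_valP.
- exact: inj_comp enum_val_inj.
apply/setP=> y; apply/imsetP/imsetP=> [[i _ ->]|[x Ax ->]].
  by exists (enum_val i); rewrite ?enum_valP.
by exists (enum_rank_in Ax x); rewrite //= enum_rankK_in.
Qed.

Lemma corank_pivot (W : finType) (C : fmatrix (option W))
    (D : fmatrix W) (A : {set W}) :
  C None None = 1 ->
  {in A &, forall x y,
     D x y = C (Some x) (Some y) + C (Some x) None * C None (Some y)} ->
  corank (principal C (None |: Some @: A)) = corank (principal D A).
Proof.
move=> C1 CD.
have NoneNA : None \notin Some @: A by apply/imsetP=> -[].
(* List [None] first, so that the matrix becomes a block matrix with the pivot in its top left
   corner. *)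
pose f (i : 'I_(1 + #|A|)) :=
  if split i is inr j then Some (enum_val j) else None.
have fl i : f (lshift _ i) = None by rewrite /f (unsplitK (inl i)).
have fr i : f (rshift _ i) = Some (enum_val i) by rewrite /f (unsplitK (inr i)).
rewrite /corank -(@mxrank_principal _ C _ _ f).
- rewrite cardsU1 NoneNA card_imset; last exact: Some_inj.
  have -> : \matrix_(i, j) C (f i) (f j) =
    block_mx 1%:M (\row_j C None (Some (enum_val j)))
      (\col_i C (Some (enum_val i)) None)
      (\matrix_(i, j) C (Some (enum_val i)) (Some (enum_val j))).
    apply/matrixP=> i j; rewrite mxE.
    case: (split_ordP i) => i' ->; case: (split_ordP j) => j' ->;
      rewrite ?(block_mxEul, block_mxEur, block_mxEdl, block_mxEdr) ?mxE
              ?fl ?fr //.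
    by rewrite C1 !ord1.
  (* Size and rank both drop by one, so the corank is unchanged. *)
  rewrite mxrank_block_pivot add1n subSS; congr (_ - \rank _)%N.
  apply/matrixP=> i j; rewrite !mxE big_ord1 !mxE CD ?enum_valP //.
  (* In characteristic 2 the minus sign of the Schur complement is the plus sign in the hypothesis
     on [D]. *)
  by rewrite (oppr_pchar2 (pchar_Fp _)).
- move=> i j; case: (split_ordP i) => i' ->; case: (split_ordP j) => j' ->;
    rewrite ?fl ?fr ?ord1 //.
  by case=> /enum_val_inj ->.
apply/setP=> -[x|]; apply/imsetP/idP; rewrite !inE //=.
- case=> i _; case: (split_ordP i) => i' ->; rewrite ?fl ?fr // => -[->].
  by rewrite imset_f ?enum_valP.
- rewrite mem_imset; last exact: Some_inj.
  by move=> Ax; exists (rshift _ (enum_rank_in Ax x)); rewrite ?fr ?enum_rankK_in.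
by move=> _; exists (lshift _ ord0).
Qed.

(** This is the normalized sum S(C), free of the global factor z^rank(C). *)
Definition corank_sum (W : finType) (C : fmatrix W) : laurent_field :=
  \sum_(A : {set W}) z ^ (- (corank (principal (fmx_add C (fmx_diag A)) A))%:Z).

Lemma z_neq0 : z != 0.
Proof. by rewrite tofrac_eq0 polyX_eq0. Qed.

Lemma partial_dtdE (W : finType) (C : fmatrix W) :
  partial_dtd C = z ^ (fmx_rank C)%:Z * corank_sum C.
Proof. by rewrite mulr_sumr; apply: eq_bigr => A _; rewrite expfzDr ?z_neq0. Qed.

Lemma corank_sumE (W : finType) (C : fmatrix W) :
  z ^ (- (fmx_rank C)%:Z) * partial_dtd C = corank_sum C.
Proof. by rewrite partial_dtdE mulrA -expfzDr ?z_neq0 // addNr mul1r. Qed.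

Lemma corank_sum_bij (W W' : finType) (h : W -> W') (C : fmatrix W')
    (D : fmatrix W) :
  bijective h -> (forall x y, C (h x) (h y) = D x y) ->
  corank_sum C = corank_sum D.
Proof.
move=> bij_h CD; have inj_h := bij_inj bij_h.
have bij_im : bijective (fun A : {set W} => h @: A).
  case: bij_h => g hK gK; exists (fun A : {set W'} => g @: A) => A;
    rewrite -imset_comp -[RHS]imset_id; exact: eq_imset.
rewrite /corank_sum (reindex _ (onW_bij _ bij_im)); apply: eq_bigr => A _.
rewrite (corank_imset (D := fmx_add D (fmx_diag A))) // => x y _ _.
by rewrite /fmx_add /fmx_diag CD (inj_eq inj_h) mem_imset.
Qed.

(** [D] and [E] are specified entrywise, so that each use may supply its own form of the deleted
    matrix and of the Schur complement. *)
Lemma corank_sum_pivot (W : finType) (C : fmatrix (option W))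
    (D E : fmatrix W) :
  C None None = 0 ->
  (forall x y, D x y = C (Some x) (Some y)) ->
  (forall x y, E x y = D x y + C (Some x) None * C None (Some y)) ->
  corank_sum C = corank_sum D + corank_sum E.
Proof.
move=> C0 CD DE; have inj_Some : injective (@Some W) by move=> x y [].
have NoneN (A : {set W}) : None \notin Some @: A by apply/imsetP=> -[].
have preK (A : {set W}) : Some @^-1: (Some @: A) = A.
  by apply/setP=> x; rewrite inE mem_imset.
have preK1 (A : {set W}) : Some @^-1: (None |: Some @: A) = A.
  by apply/setP=> x; rewrite !inE mem_imset.
rewrite /corank_sum (bigID (fun A : {set option W} => None \notin A)) /=.
congr (_ + _).
- rewrite (reindex_onto (fun A : {set W} => Some @: A)
    (fun A => Some @^-1: A)) /=; last first.
    move=> A NA; apply/setP=> -[x|]; first by rewrite mem_imset ?inE.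
    by rewrite (negPf NA) (negPf (NoneN _)).
  apply: eq_big => [A|A _]; first by rewrite NoneN preK eqxx.
  rewrite (corank_imset (D := fmx_add D (fmx_diag A))) // => x y _ _.
  by rewrite /fmx_add /fmx_diag CD (inj_eq inj_Some) mem_imset.
rewrite (reindex_onto (fun A : {set W} => None |: Some @: A)
  (fun A => Some @^-1: A)) /=; last first.
  move=> A /negPn NA; apply/setP=> -[x|]; last by rewrite !inE NA.
  by rewrite !inE mem_imset ?inE.
apply: eq_big => [A|A _]; first by rewrite !inE preK1 !eqxx.
rewrite (corank_pivot (D := fmx_add E (fmx_diag A))) //.
  by rewrite /fmx_add /fmx_diag C0 !inE eqxx add0r.
(* Adding I leaves the row and column of [None] unchanged off the diagonal, so it commutes with
   taking the Schur complement. *)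
move=> x y _ _; rewrite /fmx_add /fmx_diag /= !addr0 DE CD.
by rewrite !inE (inj_eq inj_Some) /= mem_imset // addrAC.
Qed.

Theorem theorem4p1 (V : finType) (M : fmatrix V) (u v : V)
    (P Q : minus2 u v -> 'F_2) (N : fmatrix (minus2 u v))
    (M_sym : forall x y : V, M x y = M y x)
    (u_neq_v : u != v)
    (M_uu : M u u = 0) (M_uv : M u v = 1)
    (M_vu : M v u = 1) (M_vv : M v v = 0)
    (M_uV' : forall y : minus2 u v, M u (val y) = P y)
    (M_vV' : forall y : minus2 u v, M v (val y) = Q y)
    (M_V'u : forall x : minus2 u v, M (val x) u = P x)
    (M_V'v : forall x : minus2 u v, M (val x) v = Q x)
    (M_V'V' : forall x y : minus2 u v, M (val x) (val y) = N x y) :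
  let NQ : fmatrix (minus2 u v) := fmx_add N (fmx_outer Q) in
  let H : fmatrix (option (minus2 u v)) :=
    fmx_border 1 (fun x => P x + Q x) (fmx_add N (fmx_outer P)) in
  partial_dtd M =
    z ^ (fmx_rank M)%:Z *
      (z ^ (- (fmx_rank N)%:Z) * partial_dtd N
       + z ^ (- (fmx_rank NQ)%:Z) * partial_dtd NQ
       + z ^ (- (fmx_rank H)%:Z) * partial_dtd H).
Proof.
move=> NQ H; rewrite !corank_sumE partial_dtdE; congr (_ * _).
(* The outer [None] stands for [u] and the inner one for [v], so successive pivots on [None] treat
   [u] and then [v]. *)
pose h (x : option (option (minus2 u v))) : V :=
  match x with None => u | Some None => v | Some (Some y) => val y end.
have uN (y : minus2 u v) : val y != u /\ val y != v.
  by have := valP y; rewrite !inE negb_or => /andP.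
have bij_h : bijective h.
  pose g x : option (option (minus2 u v)) :=
    if x == u then None else if x == v then Some None else Some (insub x).
  exists g => [[[y|]|]|x]; rewrite /g /h.
  - by have [/negPf -> /negPf ->] := uN y; rewrite valK.
  - by rewrite eq_sym (negPf u_neq_v) eqxx.
  - by rewrite eqxx.
  have [-> //|xu] := eqVneq x u; have [-> //|xv] := eqVneq x v.
  by rewrite insubT // !inE negb_or xu.
rewrite (corank_sum_bij (h := h) (D := fun x y => M (h x) (h y))) //.
rewrite (corank_sum_pivot (D := fmx_border 0 Q N) (E := H)) //=.
- congr (_ + _); apply: corank_sum_pivot => // x y.
- by case=> [x|] [y|] /=; rewrite ?M_V'V' ?M_V'v ?M_vV' ?M_vv.
(* The Schur complement at [u] is [H]: its corner is 0 + 1 * 1, its border Q + P, and its main block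
   N + PP^T. *)
case=> [x|] [y|] /=; rewrite ?M_V'u ?M_uV' ?M_vu ?M_uv //.
- by rewrite mulr1 addrC.
- by rewrite mul1r addrC.
by rewrite mul1r add0r.
Qed.
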